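(* For each of the following pairs $(p,\beta)$, there exist exponentially many infinite words over the ternary alphabet $\{0,1,2\}$ that are $\beta^+$-free and contain at most $p$ distinct palindromes (the empty word being counted as a palindrome): (a) $(5,\tfrac{10}{3})$; (b) $(6,\tfrac{9}{4})$; (c) $(7,2)$; (d) $(16,\tfrac{52}{27})$; (e) $(17,\tfrac{25}{13})$; (f) $(18,\tfrac{7}{4})$. That is, for each such pair there is a real constant $c>1$ such that, for all sufficiently large $n$, at least $c^n$ distinct words of length $n$ occur as factors of infinite ternary $\beta^+$-free words containing at most $p$ distinct palindromes.
   Context: An infinite word is a right-infinite sequence of letters. For a nonempty finite word $u$ and a rational $r>1$, a word $v$ is an $r$-power (of $u$) if $v$ is a prefix of the infinite periodic word $uuu\cdots$ and $|v|/|u|=r$. A word is $\beta^+$-free if none of its factors (contiguous blocks) is an $r$-power with $r>\beta$. A palindrome is a finite word equal to its reversal; a word contains a palindrome if the palindrome is one of its factors. The number of palindromes always refers to the number of distinct palindromes, including the empty word. *)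

(* Defs.v *)
From mathcomp Require Import all_boot all_order all_algebra.
From mathcomp Require Import all_classical all_reals.

Set Implicit Arguments.
Unset Strict Implicit.
Unset Printing Implicit Defensive.

Import Order.TTheory GRing.Theory Num.Theory.
Local Open Scope ring_scope.

Definition infword (T : Type) : Type := nat -> T.

Definition is_prefix (T : Type) (v : seq T) (w : infword T) : Prop :=
  v = mkseq w (size v).

Definition is_factor (T : Type) (v : seq T) (w : infword T) : Prop :=
  exists i : nat, v = mkseq (fun k => w (i + k)%N) (size v).

(* The infinite word uuu... for u nonempty; the default letter x0 is then
   never used, since (n %% size u < size u)%N. *)
Definition omega_power (T : Type) (x0 : T) (u : seq T) : infword T :=
  fun n => nth x0 u (n %% size u)%N.

Definition is_power_of (T : Type) (r : rat) (u v : seq T) : Prop :=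
  if u is x :: _ then
    [/\ 1 < r, is_prefix v (omega_power x u)
      & (size v)%:R / (size u)%:R = r]
  else False.

(* [plus_free beta w] : w is beta^+-free. *)
Definition plus_free (T : Type) (beta : rat) (w : infword T) : Prop :=
  forall (r : rat) (u v : seq T),
    beta < r -> is_factor v w -> ~ is_power_of r u v.

(* The empty word belongs to this set for every w. *)
Definition palindromes (T : Type) (w : infword T) : set (seq T) :=
  [set v | is_factor v w /\ rev v = v]%classic.

Definition at_most_palindromes (T : Type) (p : nat) (w : infword T) : Prop :=
  (palindromes w #<= `I_p)%card.

(* The number of words of length n over T that occur as factors of some
   infinite word satisfying P. *)
Definition nb_factors (T : finType) (P : infword T -> Prop) (n : nat) : nat :=
  #|[pred v : n.-tuple T |
      `[< exists w : infword T, P w /\ is_factor (tval v) w >]]|.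

Definition exponentially_many (R : realType) (T : finType)
    (P : infword T -> Prop) : Prop :=
  exists c : R, 1 < c /\
    exists N : nat, forall n : nat, (N <= n)%N ->
      c ^+ n <= (nb_factors P n)%:R.

(* Main.v *)
(* A single infinite word over four letters, the fixed point of a cyclic
   16-uniform morphism, is (3/2)^+-free. In each case it is mapped to a ternary
   word by a uniform code having two different blocks for the letter 0, chosen
   independently at each occurrence of 0; as every aligned factor of length 16
   contains a 0, this gives exponentially many factors. The code is
   synchronizing: two equal factors of some moderate length start at the same
   place in their blocks. Hence a long repetition in the image has a period
   q * p', and comes from a repetition of period p' in the four-letter word,
   whose excess (length minus period) is at most p' / 2; decoding loses only
   the common prefixes and suffixes of distinct blocks, which the gap between
   3/2 and beta compensates. The remaining repetitions and all the palindromes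
   are short, and are checked on the products of two blocks. The same argument,
   without loss because two blocks of the cyclic morphism agree nowhere, shows
   by induction on the period that the fixed point is (3/2)^+-free. *)
Require Import Defs.
From Stdlib Require Import BinNat Nnat.
From Stdlib Require Import(notations) String.
From mathcomp Require Import all_boot all_order all_algebra.
From mathcomp Require Import all_classical all_reals.
From mathcomp Require Import zify ring lra.

Set Implicit Arguments.
Unset Strict Implicit.
Unset Printing Implicit Defensive.

Import Order.TTheory GRing.Theory Num.Theory.

Local Open Scope nat_scope.

Implicit Types (w : nat -> nat) (s t : seq nat) (H : seq (seq nat)).

(** * Repetitions in finite words, bounded by computation *)

Definition match_at w i P m := forall k, k < m -> w (i + k) = w (i + P + k).

(* With [m] the excess of a repetition of period [P], this says that [w] is
   [beta^+]-free for [beta = 1 + a / b]. *)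
Definition run_bounded a b w :=
  forall i P m, 0 < P -> match_at w i P m -> b * m <= a * P.

(** [k] is the number of further consecutive agreements allowed; a disagreement resets it to [L].
    Starting below [L] gives the common prefix a bound of its own. *)
Fixpoint short_runs L k s t : bool :=
  match s, t with
  | x :: s', y :: t' =>
      if eqn x y then if k is k'.+1 then short_runs L k' s' t' else false
      else short_runs L L s' t'
  | _, _ => true
  end.

Lemma short_runsP L k s t : k <= L -> short_runs L k s t ->
  (forall m, m <= size s -> m <= size t ->
     (forall j, j < m -> nth 0 s j = nth 0 t j) -> m <= k) /\
  (forall i m, i + m <= size s -> i + m <= size t ->
     (forall j, j < m -> nth 0 s (i + j) = nth 0 t (i + j)) -> m <= L).
Proof.
elim: s t k => [|x s IH] [|y t] k kL.
- by move=> _; split=> [m|i m] /=; lia.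
- by move=> _; split=> [m|i m] /=; lia.
- by move=> _; split=> [m|i m] /=; lia.
rewrite /= eqnE; case: eqP => [xy|xy].
  case: k kL => // k kL /(IH _ _ (ltnW kL)) [IH1 IH2].
  have pre m : m <= (size s).+1 -> m <= (size t).+1 ->
      (forall j, j < m -> nth 0 (x :: s) j = nth 0 (y :: t) j) -> m <= k.+1.
    case: m => // m ms mt E; apply: IH1 => // j jm; exact: (E j.+1).
  split=> // -[|i] m ms mt E.
    by apply: leq_trans (pre _ ms mt E) kL.
  by apply: (IH2 i) => // j /E.
move=> /(IH _ _ (leqnn L)) [IH1 IH2].
have pre m : (forall j, j < m -> nth 0 (x :: s) j = nth 0 (y :: t) j) -> m = 0.
  by case: m => // m /(_ 0 isT).
split=> [m _ _ /pre -> //|[|i] m ms mt E]; first by rewrite (pre _ E).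
by apply: (IH2 i) => // j /E.
Qed.

(* The invariant [b * L + r = a * P] avoids dividing the large unary number
   [a * P]. *)
Fixpoint periods_ok a b H P L r n : bool :=
  if n is n'.+1 then
    let L' := L + (r + a) %/ b in
    all (fun s => short_runs L' L' s (drop P.+1 s)) H
      && periods_ok a b H P.+1 L' ((r + a) %% b) n'
  else true.

Lemma periods_okP a b H P L r n : b * L + r = a * P ->
  periods_ok a b H P L r n ->
  forall s i p m, s \in H -> P < p -> p <= P + n -> i + p + m <= size s ->
    (forall j, j < m -> nth 0 s (i + j) = nth 0 s (i + p + j)) ->
    b * m <= a * p.
Proof.
elim: n P L r => [|n IH] P L r inv /=; first by lia.
case/andP=> /allP Hok /IH{}IH s i p m sH Pp pn le_s E.
have inv' : b * (L + (r + a) %/ b) + (r + a) %% b = a * P.+1.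
  by rewrite mulnDr -addnA (mulnC b (_ %/ _)) -divn_eq mulnS; lia.
case: (ltngtP p P.+1) => [||pP]; [by lia| |]; last first.
  have /(short_runsP (leqnn _)) [_ /(_ i m)] := Hok _ sH.
  rewrite size_drop => /(_ _ _ _) lem.
  apply: (@leq_trans (b * (L + (r + a) %/ b))); last by rewrite pP -inv'; lia.
  rewrite leq_mul2l; apply/orP; right; apply: lem; try lia.
  by move=> j jm; rewrite nth_drop E // pP; congr nth; lia.
by move=> pP; apply: (IH inv' s i) => //; lia.
Qed.

(** * Synchronization of labelled words *)

Fixpoint child c (S : seq (N * seq nat)) : seq (N * seq nat) :=
  match S with
  | (r, x :: t) :: S' => if eqn x c then (r, t) :: child c S' else child c S'
  | (_, [::]) :: S' => child c S'
  | [::] => [::]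
  end.

Definition same_label (S : seq (N * seq nat)) : bool :=
  if S is (r, _) :: S' then all (fun p => N.eqb p.1 r) S' else true.

(* Refines, letter by letter, the classes of words of [S] with equal prefixes
   of length at most [M] until all the labels in each class coincide. *)
Fixpoint sync_ok (A : seq nat) M S : bool :=
  if same_label S then true
  else if M is M'.+1 then all (fun c => sync_ok A M' (child c S)) A else false.

Lemma mem_child S r x t : (r, x :: t) \in S -> (r, t) \in child x S.
Proof.
elim: S => //= -[r' [|y s]] S IH; rewrite inE.
  by case/orP=> [/eqP[]|/IH].
rewrite eqnE; case/orP=> [/eqP[-> -> ->]|/IH{}IH].
  by rewrite eqxx mem_head.
by case: eqP => // _; rewrite inE IH orbT.
Qed.

Lemma same_labelP S r1 r2 t1 t2 :
  same_label S -> (r1, t1) \in S -> (r2, t2) \in S -> r1 = r2.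
Proof.
case: S => //= -[r s] S /allP Hr.
suff main r' t' : (r', t') \in (r, s) :: S -> r' = r.
  by move=> /main -> /main ->.
by rewrite inE => /orP[/eqP[]|/Hr /N.eqb_eq].
Qed.

(** The two words share their first letter, which lies in [A], so both stay in one class that the
    search visits, until the labels of that class coincide. *)
Lemma sync_okP A M S r1 r2 t1 t2 : sync_ok A M S ->
  (r1, t1) \in S -> (r2, t2) \in S -> M <= size t1 -> M <= size t2 ->
  all (mem A) t1 ->
  (forall k, k < M -> nth 0 t1 k = nth 0 t2 k) -> r1 = r2.
Proof.
elim: M S t1 t2 => [|M IH] S t1 t2 /=.
  by case: ifP => // /same_labelP lem _ h1 h2 _ _ _ _; exact: lem h1 h2.
case: ifP => [/same_labelP lem _ h1 h2 _ _ _ _|_ /allP okS].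
  exact: lem h1 h2.
case: t1 => // x t1; case: t2 => // y t2 h1 h2 s1 s2 /= /andP[xA t1A] E.
have xy : x = y := E 0 isT.
apply: (IH (child x S) t1 t2) => //; first exact: okS.
- exact: mem_child h1.
- by rewrite xy; exact: mem_child h2.
- by move=> k kM; apply: (E k.+1).
Qed.

(** * Uniform codes and the repetitions in their images *)

Definition block H x := nth [::] H x.

(** These pairs serve twice: as consecutive blocks of an image, and as distinct blocks facing each
    other in a repetition. *)
Definition apart (pi : nat -> nat) H : seq (nat * nat) :=
  [seq p <- [seq (x, y) | x <- iota 0 (size H), y <- iota 0 (size H)]
     | ~~ eqn (pi p.1) (pi p.2)].

Definition two_blocks pi H : seq (seq nat) :=
  [seq block H p.1 ++ block H p.2 | p <- apart pi H].

Fixpoint tails n s : seq (seq nat) :=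
  if n is n'.+1 then s :: tails n' (behead s) else [::].

(** A label is the offset of the window in its block, in binary to make comparisons cheap. *)
Definition windows q (T : seq (seq nat)) : seq (N * seq nat) :=
  let labels := [seq N.of_nat r | r <- iota 0 q] in
  flatten [seq zip labels (tails q s) | s <- T].

(* Block [x] of the code is [block H x], of length [q] over the alphabet [A];
   [pi x] is the letter that it encodes (several blocks may encode the same
   letter). Two blocks suffice as context, since a violation at a period
   [p <= P] fits into [q.+1] letters, and a match at a period [p > P] that
   violates the bound has length at least [M] and so forces [q %| p]. Blocks
   with different [pi] agree on at most [c1] first letters, [c2] last letters
   and [D] consecutive letters. *)
Definition code_ok (A : seq nat) q a b M P D c1 c2 pi H : bool :=
  [&& all (fun s => (size s == q) && all (mem A) s) H,
      [&& D < q, c1 <= D, c2 <= D & M <= q.+1],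
      [&& 0 < b, P + (a * P) %/ b <= q & b * M <= a * P.+1 + b],
      all (fun p => short_runs D c1 (block H p.1) (block H p.2)
             && short_runs D c2 (rev (block H p.1)) (rev (block H p.2)))
          (apart pi H),
      periods_ok a b (two_blocks pi H) 0 0 0 P
    & sync_ok A M (windows q (two_blocks pi H))].

Definition image H q (v : nat -> nat) : nat -> nat :=
  fun n => nth 0 (block H (v (n %/ q))) (n %% q).

Definition admissible (pi : nat -> nat) H (v : nat -> nat) :=
  forall j, v j < size H /\ pi (v j) <> pi (v j.+1).

Lemma tailsE n s : tails n s = [seq drop r s | r <- iota 0 n].
Proof.
elim: n s => //= n IH s; rewrite drop0 IH (iotaDl 1) -map_comp.
by congr (_ :: _); apply: eq_map => r /=; rewrite -drop1 drop_drop addnC.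
Qed.

Lemma mem_apart pi H x y : x < size H -> y < size H -> pi x <> pi y ->
  (x, y) \in apart pi H.
Proof.
move=> xH yH /eqP xy; rewrite mem_filter /= eqnE xy.
by apply/allpairsP; exists (x, y); rewrite !mem_iota.
Qed.

Lemma mem_two_blocks pi H v j : admissible pi H v ->
  block H (v j) ++ block H (v j.+1) \in two_blocks pi H.
Proof.
move=> adm; apply/mapP; exists (v j, v j.+1) => //.
by apply: mem_apart; [exact: (adm j).1|exact: (adm j.+1).1|exact: (adm j).2].
Qed.

Lemma image_block H q v j r : r < q ->
  image H q v (j * q + r) = nth 0 (block H (v j)) r.
Proof.
move=> rq; have q0 : 0 < q by lia.
by rewrite /image divnMDl // divn_small // addn0 modnMDl modn_small.
Qed.

Lemma image_two_blocks H q v j r : (forall x, x < size H -> size (block H x) = q) ->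
  (forall i, v i < size H) -> r < q + q ->
  image H q v (j * q + r) = nth 0 (block H (v j) ++ block H (v j.+1)) r.
Proof.
move=> szH vH rq; rewrite nth_cat szH //.
case: ltnP => rq'; first by rewrite image_block.
rewrite -(@image_block H q v) ?mulSn; last by lia.
by congr image; lia.
Qed.

Lemma size_block A q a b M P D c1 c2 pi H x :
  code_ok A q a b M P D c1 c2 pi H -> x < size H -> size (block H x) = q.
Proof.
by move=> /andP[/(all_nthP [::]) sz _] /sz /andP[/eqP].
Qed.

(** The windows at [i] and [i + p] agree on [M] letters, so [sync_ok] gives them the same offset
    modulo [q]. *)
Lemma image_sync A q a b M P D c1 c2 pi H v i p m :
  code_ok A q a b M P D c1 c2 pi H -> admissible pi H v ->
  match_at (image H q v) i p m -> M <= m -> q %| p.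
Proof.
move=> ok adm E Mm; have sz := size_block ok.
have vH j : v j < size H := (adm j).1.
case/and5P: (ok) => lets /and4P[Dq c1D c2D Mq] _ _ /andP[_ sync].
have q0 : 0 < q by lia.
pose T j := block H (v j) ++ block H (v j.+1).
have szT j : size (T j) = q + q by rewrite size_cat !sz.
(* The offset is at most [q - 1], so at least [q.+1 >= M] letters of the two blocks remain. *)
pose win n := drop (n %% q) (T (n %/ q)).
have mem_win n : (N.of_nat (n %% q), win n) \in windows q (two_blocks pi H).
  apply/flatten_mapP; exists (T (n %/ q)); first exact: mem_two_blocks.
  rewrite tailsE zip_map; apply: (map_f (fun r => (N.of_nat r, _))).
  by rewrite mem_iota ltn_mod.
have szw n : M <= size (win n).
  by rewrite size_drop szT; have := ltn_pmod n q0; lia.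
have lw n : all (mem A) (win n).
  suff: all (mem A) (T (n %/ q)).
    by rewrite -{1}(cat_take_drop (n %% q) (T _)) all_cat => /andP[].
  rewrite all_cat; apply/andP; split.
    by case/(all_nthP [::])/(_ _ (vH (n %/ q)))/andP: lets.
  by case/(all_nthP [::])/(_ _ (vH (n %/ q).+1))/andP: lets.
have nthw n k : k < M -> nth 0 (win n) k = image H q v (n + k).
  move=> kM; rewrite nth_drop -(@image_two_blocks H q v) //.
    by rewrite {3}(divn_eq n q) addnA.
  by have := ltn_pmod n q0; lia.
have := sync_okP sync (mem_win i) (mem_win (i + p)) (szw _) (szw _) (lw _).
move=> /(_ _)/Nat2N.inj res.
have {}res : i %% q = (i + p) %% q.
  by apply: res => k kM; rewrite !nthw // E //; lia.
by move/eqP: res; rewrite -{1}(addn0 i) eqn_modDl mod0n eq_sym.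
Qed.

(** A violation contains one of the least possible excess [L.+1]; the bound on [P] makes it fit into
    two consecutive blocks, where [periods_ok] excludes it. *)
Lemma image_short_period A q a b M P D c1 c2 pi H v i p m :
  code_ok A q a b M P D c1 c2 pi H -> admissible pi H v ->
  match_at (image H q v) i p m -> 0 < p -> p <= P -> b * m <= a * p.
Proof.
move=> ok adm E p0 pP; have sz := size_block ok.
have vH j : v j < size H := (adm j).1.
case/and5P: (ok) => _ /and4P[Dq _ _ _] /and3P[b0 Pq _] _ /andP[per _].
have q0 : 0 < q by lia.
rewrite leqNgt; apply/negP => big.
pose L := (a * p) %/ b.
have Lm : L < m by rewrite ltn_divLR //; lia.
have LP : L <= (a * P) %/ b by apply: leq_div2r; rewrite leq_mul2l pP orbT.
have bL : a * p < b * L.+1 by rewrite (mulnC b); exact: ltn_ceil.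
have rq := ltn_pmod i q0.
suff: b * L.+1 <= a * p by lia.
apply: (@periods_okP a b _ 0 0 0 P _ per _ (i %% q) _ _
  (mem_two_blocks (i %/ q) adm)); rewrite ?muln0 //.
  by rewrite size_cat !sz //; lia.
move=> j jL; rewrite -!(@image_two_blocks H q v) //; try lia.
rewrite !addnA -divn_eq; apply: E; lia.
Qed.

(** Block [j] faces block [j + p] at equal offsets. Facing blocks that decode differently can only
    occur at the two ends of the match, where they contribute at most [c2] letters on the left and
    [c1] on the right. *)
Lemma image_aligned A q a b M P D c1 c2 pi H v i p m :
  code_ok A q a b M P D c1 c2 pi H -> admissible pi H v ->
  match_at (image H q v) i (q * p) m ->
  m <= D \/
  exists j m', match_at (pi \o v) j p m' /\ m <= q * m' + c1 + c2.
Proof.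
move=> ok adm E; have sz := size_block ok.
have vH j : v j < size H := (adm j).1.
case/and5P: (ok) => _ /and4P[Dq c1D c2D _] _ /allP runs _.
have q0 : 0 < q by lia.
have rq := ltn_pmod i q0.
have agree j r : r < q -> i <= j * q + r < i + m ->
    nth 0 (block H (v j)) r = nth 0 (block H (v (j + p))) r.
  move=> rq' /andP[ij jm]; rewrite -!(@image_block H q v) //.
  have := E (j * q + r - i); rewrite addnAC subnKC // => -> //; last by lia.
  by congr image; rewrite mulnDl (mulnC q p); lia.
have run j r l : pi (v j) <> pi (v (j + p)) -> r + l <= q ->
    i <= j * q + r -> j * q + r + l <= i + m -> l <= D.
  move=> dif rl ij jm; have /andP[+ _] := runs _ (mem_apart (vH j) (vH _) dif).
  case/(short_runsP c1D) => _ /(_ r l); rewrite /= !sz //.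
  by move=> /(_ rl rl); apply=> k kl; apply: agree; lia.
have prefix j l : pi (v j) <> pi (v (j + p)) -> l <= q ->
    i <= j * q -> j * q + l <= i + m -> l <= c1.
  move=> dif lq ij jm; have /andP[+ _] := runs _ (mem_apart (vH j) (vH _) dif).
  case/(short_runsP c1D) => /(_ l) + _; rewrite /= !sz //.
  by move=> /(_ lq lq); apply=> k kl; apply: agree; lia.
have suffix j l : pi (v j) <> pi (v (j + p)) -> l <= q ->
    i <= j * q + (q - l) -> j * q + q <= i + m -> l <= c2.
  move=> dif lq ij jm; have /andP[_] := runs _ (mem_apart (vH j) (vH _) dif).
  case/(short_runsP c2D) => /(_ l) + _; rewrite /= !size_rev !sz //.
  move=> /(_ lq lq); apply=> k kl.
  by rewrite !nth_rev ?sz //; try lia; apply: agree; lia.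
case: (posnP m) => [->|m0]; first by left.
set j0 := i %/ q; set j1 := (i + m).-1 %/ q.
have ei : i = j0 * q + i %% q := divn_eq i q.
have e1 : (i + m).-1 = j1 * q + (i + m).-1 %% q := divn_eq _ q.
have r1 := ltn_pmod (i + m).-1 q0.
have j01 : j0 <= j1 by apply: leq_div2r; lia.
(* A block strictly inside the match agrees on all its [q > D] letters. *)
have inner j : j0 < j < j1 -> pi (v j) = pi (v (j + p)).
  move=> /andP[jj0 jj1]; apply/eqP/negPn/negP => /eqP dif.
  have h0 : j0.+1 * q <= j * q by rewrite leq_mul2r jj0 orbT.
  have h1 : j.+1 * q <= j1 * q by rewrite leq_mul2r jj1 orbT.
  rewrite !mulSn in h0 h1.
  have := run j 0 q dif; lia.
case: (ltngtP j0 j1) j01 => // [j01|j01] _; last first.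
  case: (pi (v j0) =P pi (v (j0 + p))) => [same|dif].
    right; exists j0, 1; split; first by case=> // _; rewrite /= !addn0.
    by rewrite -j01 in e1; lia.
  left; apply: (run j0 (i %% q) m dif); rewrite -j01 in e1; lia.
right.
have full : j0.+1 * q <= j1 * q by rewrite leq_mul2r j01 orbT.
have [k ek] : exists k, j1 = j0 + k.+1 by exists (j1 - j0.+1); lia.
rewrite ek mulnDl !mulSn in full e1.
(* An end block that decodes alike is counted in [m']; otherwise its share is bounded by [suffix] or
   [prefix]. *)
case: (pi (v j0) =P pi (v (j0 + p))) => [s0|d0];
case: (pi (v j1) =P pi (v (j1 + p))) => [s1|d1].
- exists j0, k.+2; split; last by rewrite (mulnC q) !mulSn; lia.
  move=> l lk; case: (posnP l) => [->|l0]; first by rewrite !addn0.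
  rewrite /= addnAC; case: (ltngtP (j0 + l) j1) => h; [|lia|by rewrite h].
  by apply: inner; lia.
- exists j0, k.+1; split.
    move=> l lk; case: (posnP l) => [->|l0]; first by rewrite !addn0.
    by rewrite /= addnAC; apply: inner; lia.
  have := prefix j1 ((i + m).-1 %% q).+1 d1.
  by rewrite ek mulnDl !mulSn (mulnC q) !mulSn; lia.
- exists j0.+1, k.+1; split.
    move=> l lk; rewrite /= addnAC addSnnS.
    case: (ltngtP (j0 + l.+1) j1) => h; [|lia|by rewrite h].
    by apply: inner; lia.
  have := suffix j0 (q - i %% q) d0.
  by rewrite (mulnC q) !mulSn; lia.
- exists j0.+1, k; split.
    by move=> l lk; rewrite /= addnAC; apply: inner; lia.
  have := suffix j0 (q - i %% q) d0.
  have := prefix j1 ((i + m).-1 %% q).+1 d1.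
  by rewrite ek mulnDl !mulSn (mulnC q); lia.
Qed.

Lemma image_run A q a b M P D c1 c2 pi H v i p m :
  code_ok A q a b M P D c1 c2 pi H -> admissible pi H v ->
  match_at (image H q v) i p m -> 0 < p ->
  b * m <= a * p \/
  exists2 p', p = q * p' & m <= D \/
    exists j m', match_at (pi \o v) j p' m' /\ m <= q * m' + c1 + c2.
Proof.
move=> ok adm E p0.
case/and5P: (ok) => _ _ /and3P[b0 _ bM] _ _.
case: (leqP p P) => [pP|Pp]; first by left; exact: image_short_period ok adm E p0 pP.
case: (leqP (b * m) (a * p)) => [le|big]; [by left|right].
(* A violation has [b * m > a * p >= a * P.+1 >= b * M - b]. *)
have Mm : M <= m.
  rewrite -ltnS -(ltn_pmul2l b0) (mulnS b m).
  have : a * P.+1 <= a * p by rewrite leq_mul2l Pp orbT.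
  by lia.
have /dvdnP[p' ep] := image_sync ok adm E Mm.
rewrite mulnC in ep; exists p' => //.
by rewrite ep in E; exact: image_aligned ok adm E.
Qed.

(* The two low bits of an ASCII digit between 0 and 3 give its value. *)
Definition digits (x : String.string) : seq nat :=
  (fix go x := if x is String.String (Ascii.Ascii b0 b1 _ _ _ _ _ _) x'
               then b0 + b1.*2 :: go x' else [::]) x.

(** * The four-letter word *)

Definition base_block : seq nat := digits "0323010231013120".

Definition base_code : seq (seq nat) :=
  [seq [seq (x + c) %% 4 | x <- base_block] | c <- iota 0 4].

(* The fixed point of [c |-> nth [::] base_code c]: its [n]-th letter is the sum
   modulo 4 of [nth 0 base_block d] over the base-16 digits [d] of [n]. *)
Fixpoint digit_sum fuel n : nat :=
  if fuel is f.+1 then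
    (nth 0 base_block (n %% 16) + digit_sum f (n %/ 16)) %% 4
  else 0.

Definition base_word n : nat := digit_sum n n.

(** Leading zero digits contribute nothing because [base_block] starts with 0, so surplus fuel is
    harmless. *)
Lemma digit_sum_fuel f g n : n <= f -> n <= g -> digit_sum f n = digit_sum g n.
Proof.
have ds0 h : digit_sum h 0 = 0 by elim: h => //= h ->.
elim: f g n => [|f IH] [|g] [|n] nf ng; rewrite ?ds0 //.
rewrite [LHS]/= [RHS]/=; congr ((_ + _) %% 4).
by apply: IH; lia.
Qed.

Lemma base_word_lt4 n : base_word n < 4.
Proof. by case: n => // n; rewrite ltn_mod. Qed.

Lemma base_word_image n : base_word n = image base_code 16 base_word n.
Proof.
have rec : base_word n = (nth 0 base_block (n %% 16) + base_word (n %/ 16)) %% 4.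
  rewrite {1}/base_word (@digit_sum_fuel _ n.+1 n) //=.
  by rewrite (@digit_sum_fuel n (n %/ 16)) //; lia.
rewrite rec /image /block (nth_map 0) ?size_iota ?base_word_lt4 //.
by rewrite nth_iota ?base_word_lt4 // (nth_map 0) // ltn_mod.
Qed.

(** Inside a block this is computed; since block [c] starts and ends with [c], a boundary between
    blocks reduces to two adjacent letters at a smaller index. *)
Lemma base_word_adjacent n : base_word n <> base_word n.+1.
Proof.
have inner : all (fun c => all (fun r => nth 0 (block base_code c) r
    != nth 0 (block base_code c) r.+1) (iota 0 15)) (iota 0 4) by vm_compute.
have ends : all (fun c => (nth 0 (block base_code c) 0 == c)
    && (nth 0 (block base_code c) 15 == c)) (iota 0 4) by vm_compute.
elim/ltn_ind: n => n IH.
have en := divn_eq n 16; have := ltn_pmod n (isT : 0 < 16).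
set j := n %/ 16 in en *; set r := n %% 16 in en * => r16.
have bj k : base_word k \in iota 0 4 by rewrite mem_iota /= base_word_lt4.
rewrite !base_word_image; case: (ltnP r 15) => r15.
  rewrite {2}en -addnS en !image_block //.
  have /allP/(_ _ (bj j))/allP/(_ r) := inner.
  by rewrite mem_iota => /(_ r15)/eqP.
have r15' : r = 15 by lia.
have -> : n.+1 = j.+1 * 16 + 0 by lia.
rewrite en !image_block // r15'.
have /allP/(_ _ (bj j.+1))/andP[/eqP -> _] := ends.
have /allP/(_ _ (bj j))/andP[_ /eqP ->] := ends.
by apply: IH; lia.
Qed.

Lemma base_code_ok : code_ok (iota 0 4) 16 1 2 6 11 0 0 0 id base_code.
Proof. by vm_cast_no_check (erefl true). Qed.

(** Decoding divides the period by 16 and the excess by at most 16, as nothing is lost at the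
    ends. *)
Lemma base_word_run_bounded : run_bounded 1 2 base_word.
Proof.
have adm : admissible id base_code base_word.
  by move=> j; split; [exact: base_word_lt4|exact: base_word_adjacent].
move=> i p; elim/ltn_ind: p i => p IH i m p0 E.
have {}E : match_at (image base_code 16 base_word) i p m.
  by move=> k km; rewrite -!base_word_image; exact: E.
have [//|[p' ep [|[j [m' [E' mm']]]]]] := image_run base_code_ok adm E p0.
  by rewrite leqn0 => /eqP ->; rewrite muln0.
have := IH p' _ j m' _ E'; lia.
Qed.

(** The three inequalities treat a match within one pair of facing blocks, the decoded period 1
    (whose excess is 0), and the decoded periods from 2 on, for which 2 is the worst case. *)
Lemma image_run_bounded A q a b M P D c1 c2 pi H v :
  code_ok A q a b M P D c1 c2 pi H -> admissible pi H v ->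
  run_bounded 1 2 (pi \o v) ->
  b * D <= a * q -> b * (c1 + c2) <= a * q ->
  b * (c1 + c2) + b * q <= 2 * (a * q) ->
  run_bounded a b (image H q v).
Proof.
move=> ok adm bnd hD h1 h2 i p m p0 E.
have [//|[p' ep [mD|[j [m' [E' mm']]]]]] := image_run ok adm E p0.
  apply: leq_trans (leq_trans hD _); first by rewrite leq_mul2l mD orbT.
  by rewrite leq_mul2l ep leq_pmulr ?orbT //; lia.
have p'0 : 0 < p' by lia.
have := bnd j p' m' p'0 E'; rewrite mul1n => m'p.
have : b * m <= b * (q * m' + c1 + c2) by rewrite leq_mul2l mm' orbT.
move/leq_trans; apply; rewrite ep -addnA mulnDr.
case: p' p'0 m'p {ep E'} => [|[|k]] // _ m'p.
  have -> : m' = 0 by lia.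
  by rewrite !muln0 muln1.
rewrite -(leq_pmul2l (isT : 0 < 2)) mulnDr.
have : b * q * (2 * m') <= b * q * k.+2 by rewrite leq_mul2l m'p orbT.
have : k.+2 * (b * (c1 + c2) + b * q) <= k.+2 * (2 * (a * q)).
  by rewrite leq_mul2l h2 orbT.
have : k * 0 <= k * (b * (c1 + c2)) by rewrite muln0.
nia.
Qed.

(** * Palindromes of images *)

(* Removing both ends of a palindrome leaves a palindrome, so that none is longer
   than [L] if none has length [L.+1] or [L.+2]. *)
Definition palindromes_ok L (A : seq (seq nat)) q (T : seq (seq nat)) : bool :=
  all (fun x => size x <= L) A &&
  all (fun s => all (fun u => all (fun l =>
    let t := take l u in all2 eqn (rev t) t ==> has (all2 eqn t) A)
    (iota 1 L.+2)) (tails q s)) T.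

Lemma image_palindrome q pi H v L A i l :
  (forall x, x < size H -> size (block H x) = q) -> admissible pi H v ->
  palindromes_ok L A q (two_blocks pi H) -> L < q ->
  let t := mkseq (fun k => image H q v (i + k)) l in
  0 < l -> rev t = t -> t \in A.
Proof.
move=> sz adm /andP[/allP szA /allP pal] Lq /=.
have vH j : v j < size H := (adm j).1.
have q0 : 0 < q by lia.
pose f i l := mkseq (fun k => image H q v (i + k)) l.
have szf i' l' : size (f i' l') = l' by rewrite size_mkseq.
have nthf i' l' k : k < l' -> nth 0 (f i' l') k = image H q v (i' + k).
  by move=> kl; rewrite nth_mkseq.
rewrite -/(f i l); elim/ltn_ind: l i => l IH i l0 rf.
have rq := ltn_pmod i q0.
case: (leqP l L.+2) => [lL|Ll].
  have := pal _ (mem_two_blocks (i %/ q) adm).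
  rewrite tailsE all_map => /allP/(_ (i %% q)).
  rewrite mem_iota add0n rq => /(_ isT)/allP/(_ l).
  rewrite mem_iota l0 add1n ltnS lL => /(_ isT).
  have szT : size (block H (v (i %/ q)) ++ block H (v (i %/ q).+1)) = q + q.
    by rewrite size_cat !sz.
  set T := _ ++ _ in szT *.
  have szt : size (take l (drop (i %% q) T)) = l.
    by rewrite size_takel // size_drop szT; lia.
  have -> : take l (drop (i %% q) T) = f i l.
    apply: (@eq_from_nth _ 0); first by rewrite szf.
    move=> k; rewrite szt => kl.
    rewrite nth_take // nth_drop nthf // -(@image_two_blocks H q v) //; last by lia.
    by rewrite addnA -divn_eq.
  rewrite /= rf -[all2 _ _ _]eqseq_all eqxx => /hasP[x xA].
  by rewrite -[all2 _ _ _]eqseq_all => /eqP ->.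
(* Here [l.-2 > L], whereas the words of [A] have at most [L] letters. *)
have : f i.+1 l.-2 \in A.
  apply: IH; try lia.
  apply: (@eq_from_nth _ 0); first by rewrite size_rev.
  move=> k; rewrite size_rev szf => kl.
  rewrite nth_rev szf // !nthf; try lia.
  have := congr1 (fun s => nth 0 s k.+1) rf.
  rewrite nth_rev szf ?nthf; try lia.
  by move=> h; rewrite [in RHS]addSnnS -h; congr image; lia.
by move/szA; rewrite szf; lia.
Qed.

(** * From numbers to the ternary alphabet *)

Definition letter (n : nat) : 'I_3 := inord n.

Lemma letter_inj m n : m < 3 -> n < 3 -> letter m = letter n -> m = n.
Proof. by move=> m3 n3 /(congr1 val); rewrite /= !inordK. Qed.

Lemma map_letter_inj s t : all (ltn^~ 3) s -> all (ltn^~ 3) t ->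
  map letter s = map letter t -> s = t.
Proof.
elim: s t => [|x s IH] [|y t] //= /andP[x3 s3] /andP[y3 t3].
by case=> /(letter_inj x3 y3) -> /(IH _ s3 t3) ->.
Qed.

(** A power of length [n] of a word of length [P] is a match of length [n - P] at period [P], and
    [n / P <= 1 + a / b] amounts to [b * (n - P) <= a * P]. *)
Lemma plus_free_run_bounded (T : Type) (w : infword T) a b : 0 < b ->
  (forall i P m, 0 < P -> (forall k, k < m -> w (i + k) = w (i + P + k)) ->
     b * m <= a * P) ->
  plus_free (1 + a%:R / b%:R)%R w.
Proof.
move=> b0 bnd r u v lt_r [i fac]; case: u => [|x u] //= [r1 pre er].
set P := (size u).+1 in er; set n := size v in fac pre er.
have P0 : (0 < P%:R :> rat)%R by rewrite ltr0n.
have Pn : P < n.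
  by move: r1; rewrite -er ltr_pdivlMr // mul1r ltr_nat.
have eqw k : k < n -> w (i + k) = nth x (x :: u) (k %% P).
  move=> kn; have := congr1 (fun l => nth x l k) (etrans (esym fac) pre).
  by rewrite !nth_mkseq.
have : b * (n - P) <= a * P.
  apply: (bnd i) => // k kn; rewrite -addnA !eqw; try lia.
  by rewrite modnDl.
move=> le; suff : (r <= 1 + a%:R / b%:R)%R by rewrite leNgt lt_r.
rewrite -er ler_pdivrMr // mulrDl mul1r -mulrA (mulrC b%:R^-1%R) mulrA.
rewrite -lerBlDl ler_pdivlMr ?ltr0n // -natrB; last exact: ltnW.
by rewrite -!natrM ler_nat mulnC.
Qed.

Lemma at_most_palindromes_letters (W : nat -> nat) (A : seq (seq nat)) p :
  (forall n, W n < 3) ->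
  (forall i l, let t := mkseq (fun k => W (i + k)) l in
     0 < l -> rev t = t -> t \in A) ->
  size A < p ->
  at_most_palindromes p (fun n => letter (W n)).
Proof.
move=> W3 pal szA.
(* The strict bound on [size A] leaves room for the empty word. *)
pose B := [::] :: [seq map letter x | x <- A].
have sub : (palindromes (fun n => letter (W n)) `<=` [set` B])%classic.
  move=> v [[i ev] rv]; rewrite /= inE; case: (posnP (size v)) => [/size0nil ->|v0].
    by rewrite eqxx.
  apply/orP; right; rewrite ev; set l := size v in ev v0 *.
  pose t := mkseq (fun k => W (i + k)) l.
  have et : mkseq (fun k => letter (W (i + k))) l = map letter t.
    by rewrite /t /mkseq -map_comp.
  rewrite et; apply: map_f; apply: pal => //.
  have t3 : all (ltn^~ 3) t by apply/allP => _ /mapP[k _ ->]; exact: W3.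
  apply: map_letter_inj; rewrite ?all_rev //.
  by rewrite map_rev -et -ev.
apply: card_le_trans (subset_card_le _) (card_image_le (nth [::] B) `I_p).
move=> v /sub /= vB; exists (index v B); last exact: nth_index.
by move: vB; rewrite -index_mem /= size_map => /leq_trans -> //.
Qed.

(** * Counting factors through independent binary choices *)

Lemma exponentially_many_choices (R : realType) (T : finType)
    (Q : infword T -> Prop) K (F : (nat -> bool) -> infword T) :
  0 < K -> (forall g, Q (F g)) ->
  (forall k g g' i, i < k -> g i <> g' i ->
     mkseq (F g) (k * K) <> mkseq (F g') (k * K)) ->
  exponentially_many R Q.
Proof.
move=> K0 QF inj.
(* With [c = 1 + 1 / N], [growth] gives [c ^+ (2 * K) <= 2]; as [n <= 2 * K * k], the [2 ^ k]
   choices outnumber [c ^+ n]. *)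
pose N := 4 * K; have N0 : (0 < N%:R :> R)%R by rewrite ltr0n muln_gt0.
exists (1 + N%:R^-1)%R; split; first by rewrite ltrDl invr_gt0.
exists K => n Kn; pose k := n %/ K.
have k0 : 0 < k by rewrite divn_gt0.
have nK : n <= 2 * K * k.
  by have := ltn_ceil n K0; rewrite -/k; nia.
have growth j : j <= 2 * K -> ((1 + N%:R^-1) ^+ j <= 1 + (2 * j)%:R / N%:R :> R)%R.
  elim: j => [|j IH] jK; first by rewrite expr0 muln0 mul0r addr0.
  rewrite exprS; apply: le_trans (ler_wpM2l _ (IH (ltnW jK))) _.
    by rewrite addr_ge0 // invr_ge0 ltW.
  set x := (N%:R^-1)%R; have x0 : (0 <= x)%R by rewrite invr_ge0 ltW.
  have : ((2 * j)%:R * x <= 1)%R.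
    by rewrite ler_pdivrMr // mul1r ler_nat /N; lia.
  rewrite (_ : (2 * j.+1)%:R = (2 * j)%:R + 2 :> R)%R; last first.
    by rewrite -natrD; congr (_%:R)%R; lia.
  set y := ((2 * j)%:R)%R => yx.
  have : (x * (y * x) <= x * 1)%R by apply: ler_wpM2l.
  lra.
have c1 : (1 <= 1 + N%:R^-1 :> R)%R by rewrite lerDl invr_ge0 ltW.
apply: le_trans (_ : _ <= (2 ^ k)%:R)%R _.
  apply: le_trans (ler_weXn2l c1 nK) _.
  rewrite exprM natrX; apply: lerXn2r; rewrite ?nnegrE ?exprn_ge0 ?(le_trans _ c1) //.
  apply: le_trans (growth _ (leqnn _)) _.
  rewrite (_ : (2 * (2 * K))%N = N); last by rewrite /N; lia.
  by rewrite divff ?lt0r_neq0 // -(natrD _ 1 1).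
rewrite ler_nat.
pose g (f : {ffun 'I_k -> bool}) (j : nat) := if insub j is Some i then f i else false.
have gE f (i : 'I_k) : g f i = f i by rewrite /g valK.
pose word (f : {ffun 'I_k -> bool}) := mktuple (fun i : 'I_n => F (g f) i).
have wordE f : tval (word f) = mkseq (F (g f)) n.
  apply: (@eq_from_nth _ (F (g f) 0)); first by rewrite size_tuple size_mkseq.
  move=> i; rewrite size_tuple => lt_in.
  by rewrite nth_mkseq // -[i]/(val (Ordinal lt_in)) nth_mktuple.
have word_inj : injective word.
  move=> f f' /(congr1 (@tval _ _)); rewrite !wordE => e; apply/ffunP => i.
  apply/eqP/negPn/negP => /eqP dif; apply: (inj k (g f) (g f') i) => //.
    by rewrite !gE.
  have kK : k * K <= n by exact: leq_trunc_div.
  by have := congr1 (take (k * K)) e; rewrite /mkseq -!map_take take_iota (minn_idPl kK).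
have <- : #|{ffun 'I_k -> bool}| = 2 ^ k by rewrite card_ffun card_bool card_ord.
rewrite /nb_factors -(card_imset _ word_inj); apply: subset_leq_card.
apply/fintype.subsetP => _ /imsetP[f _ ->]; rewrite inE.
exists (F (g f)); split; first exact: QF.
by exists 0; rewrite size_tuple wordE.
Qed.

(** * Codes with two blocks for the letter 0 *)

(* Blocks 0 and 4 both encode the letter 0. *)
Definition merge_variant n := if eqn n 4 then 0 else n.

(** All zeros in one aligned factor of length 16 share a bit, which can therefore be read off any of
    them. *)
Definition choose_variants (g : nat -> bool) j :=
  if (base_word j == 0) && g (j %/ 16) then 4 else base_word j.

Definition side_ok p q a b D c1 c2 H L A : bool :=
  [&& size H == 5, block H 0 != block H 4,
      [&& b * D <= a * q, b * (c1 + c2) <= a * q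
        & b * (c1 + c2) + b * q <= 2 * (a * q)],
      palindromes_ok L A q (two_blocks merge_variant H), L < q & size A < p].

Lemma base_word_zero (t : nat) : exists2 j, j %/ 16 = t & base_word j = 0.
Proof.
have zero : all (fun c => 0 \in block base_code c) (iota 0 4) by vm_compute.
have sz : all (fun c => size (block base_code c) == 16) (iota 0 4) by vm_compute.
have bt : base_word t \in iota 0 4 by rewrite mem_iota base_word_lt4.
move/allP/(_ _ bt): zero => zero; move/allP/(_ _ bt)/eqP: sz => sz.
set r := index 0 (block base_code (base_word t)).
have r16 : r < 16 by rewrite -sz index_mem.
exists (t * 16 + r); first by rewrite divnMDl // divn_small ?addn0.
by rewrite base_word_image image_block // nth_index.
Qed.

Lemma exponentially_many_code (R : realType) p q a b M P D c1 c2 H L A :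
  code_ok (iota 0 3) q a b M P D c1 c2 merge_variant H ->
  side_ok p q a b D c1 c2 H L A ->
  exponentially_many R (fun w : infword 'I_3 =>
    plus_free (1 + a%:R / b%:R)%R w /\ at_most_palindromes p w).
Proof.
move=> ok /and5P[/eqP szH neq /and3P[hD h1 h2] pal /andP[Lq szA]].
have q0 : 0 < q by lia.
have b0 : 0 < b by case/and5P: ok => _ _ /and3P[].
have merge g j : merge_variant (choose_variants g j) = base_word j.
  rewrite /choose_variants; have := base_word_lt4 j.
  case: eqP => [-> _|_]; first by case: (g _).
  by rewrite /merge_variant eqnE; case: eqP => //; lia.
have adm g : admissible merge_variant H (choose_variants g).
  move=> j; rewrite !merge szH; split; last exact: base_word_adjacent.
  by rewrite /choose_variants; have := base_word_lt4 j; case: ifP; lia.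
have sz := size_block ok.
have lt3 g n : image H q (choose_variants g) n < 3.
  case/andP: (ok) => /(all_nthP [::])/(_ _ (adm g (n %/ q)).1)/andP[szb lets] _.
  have : image H q (choose_variants g) n \in iota 0 3.
    by move/(all_nthP 0): lets; apply; rewrite (eqP szb) ltn_mod.
  by rewrite mem_iota.
apply: (@exponentially_many_choices R _ _ (16 * q)
  (fun g n => letter (image H q (choose_variants g) n))); first by lia.
  move=> g; split; last first.
    apply: (at_most_palindromes_letters (lt3 g) _ szA) => i l t.
    exact: (image_palindrome sz (adm g) pal Lq).
  have bnd : run_bounded a b (image H q (choose_variants g)).
    apply: (image_run_bounded ok (adm g) _ hD h1 h2) => i l m l0 E.
    apply: (base_word_run_bounded l0 (i := i)) => k km.
    by have := E k km; rewrite /= !merge.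
  apply: plus_free_run_bounded => // i l m l0 E; apply: (bnd i l m l0) => k km.
  exact: letter_inj (E k km).
(* A zero in the aligned factor number [t] is encoded by block 0 under one choice and by block 4
   under the other, and these blocks differ. *)
move=> k g g' t tk dif E.
have [j jt j0] := base_word_zero t.
have same r : r < q -> nth 0 (block H (choose_variants g j)) r
    = nth 0 (block H (choose_variants g' j)) r.
  move=> rq; rewrite -!(@image_block H q) //.
  have lt : j * q + r < k * (16 * q).
    have h1' : j.+1 <= k * 16 by rewrite -ltn_divLR // jt.
    have : j.+1 * q <= k * 16 * q by rewrite leq_mul2r h1' orbT.
    by rewrite mulSn mulnA; lia.
  apply: letter_inj => //.
  by have := congr1 (fun z => nth (letter 0) z (j * q + r)) E; rewrite !nth_mkseq.
have {}same : block H (choose_variants g j) = block H (choose_variants g' j).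
  have e h : size (block H (choose_variants h j)) = q := sz _ (adm h j).1.
  by apply: (@eq_from_nth _ 0) => [|r]; rewrite !e //; exact: same.
move: same dif neq; rewrite /choose_variants j0 eqxx jt /=.
by case: (g t); case: (g' t) => //= ->; rewrite eqxx.
Qed.

(** * The six codes and their verification *)

Definition code5 : seq (seq nat) :=
  map digits
   [:: "1201120112012012011201120120120112012012011201201120112012012011201120";
       "1201120112012011201201201120112012012011201201120120120112012011201120";
       "1201120112012012011201201201120120112012012011201120120112011201201120";
       "1201120112012012011201201120120120112011201201120120112011201201201120";
       "1201120112012012011201120120112012012011201201201120112012012011201120"]%string.

Definition palindromes5 : seq (seq nat) :=
  map digits
   [:: "0"; "1"; "2"; "11"]%string.

Lemma code5_ok : code_ok (iota 0 3) 70 7 3 51 21 25 25 14 merge_variant code5.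
Proof. by vm_cast_no_check (erefl true). Qed.

Lemma code5_side : side_ok 5 70 7 3 25 25 14 code5 2 palindromes5.
Proof. by vm_cast_no_check (erefl true). Qed.

Definition code6 : seq (seq nat) :=
  map digits
   [:: "21002210021022100221022100210022102100221002100221022100";
       "21002210021022100221021002102210210022102100210221002210";
       "21002210021022100210022102100210221021002210221002102210";
       "21002210021022102100210221002210221002102210210021022100";
       "21002210021022100221022100210022102210022102100221022100"]%string.

Definition palindromes6 : seq (seq nat) :=
  map digits
   [:: "0"; "1"; "2"; "00"; "22"]%string.

Lemma code6_ok : code_ok (iota 0 3) 56 5 4 29 23 22 22 8 merge_variant code6.
Proof. by vm_cast_no_check (erefl true). Qed.

Lemma code6_side : side_ok 6 56 5 4 22 22 8 code6 2 palindromes6.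
Proof. by vm_cast_no_check (erefl true). Qed.

Definition code7 : seq (seq nat) :=
  map digits
   [:: "0221021220122021022120122021021220122021";
       "0221021220122021021220120221022120122012";
       "0221021220210212201220210212202102212012";
       "0221021220210212201202212012202102122021";
       "0221021220122021022120120221022120122021"]%string.

Definition palindromes7 : seq (seq nat) :=
  map digits
   [:: "0"; "1"; "2"; "202"; "212"; "22"]%string.

Lemma code7_ok : code_ok (iota 0 3) 40 1 1 21 20 20 20 6 merge_variant code7.
Proof. by vm_cast_no_check (erefl true). Qed.

Lemma code7_side : side_ok 7 40 1 1 20 20 6 code7 3 palindromes7.
Proof. by vm_cast_no_check (erefl true). Qed.

(* Pansiot coding: after the letters [x y], the code letter 0 stands for [x] and
   1 for the third letter. *)
Fixpoint pansiot x y (code : seq nat) : seq nat :=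
  if code is c :: code' then
    let z := if c is 0 then x else 3 - x - y in z :: pansiot y z code'
  else [::].

(* In a backtracking search, long (52/27)^+-free words with 16 palindromes have
   Pansiot codes made of the two factors below, which rotate the last two
   letters [x y] to [x+1 y+1] and [x-1 y-1] modulo 3; the blocks are closed
   walks, from [0 1] to [0 1]. *)
Definition walk_word (e : seq nat) : seq nat :=
  pansiot 0 1 (flatten [seq
    digits (if x is 0 then "010110101101011010111010111"
            else "010110101101011010111010111010111010111") | x <- e]).

Definition code16 : seq (seq nat) :=
  [seq walk_word (digits x) | x <-
    [:: "011000110001100001111000111100001100001100";
    "011000110001100001111000110001111000011000";
    "011000110001100001100001111000110001111000";
    "011000110001100001100001100001111000111100";
    "011000110001111000110000111000011100001100"]%string].

Definition palindromes16 : seq (seq nat) :=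
  map digits
   [:: "0"; "1"; "2"; "010"; "020"; "101"; "121"; "202"; "212"; "01210";
       "02120"; "10201"; "12021"; "20102"; "21012"]%string.

Lemma code16_ok : code_ok (iota 0 3) 1350 25 27 631 681 878 878 175 merge_variant code16.
Proof. by vm_cast_no_check (erefl true). Qed.

Lemma code16_side : side_ok 16 1350 25 27 878 878 175 code16 5 palindromes16.
Proof. by vm_cast_no_check (erefl true). Qed.

Definition code17 : seq (seq nat) :=
  map digits
   [:: "012102120210201021201210201202120121020102120210201210212021020102" ++
         "120121020120212010201210212021020121021201020120212012102012021201" ++
         "020121021202102010212012102010212021020121021202102010212012102012" ++
         "021201020121021201020120212012102010212021020121021201020120212012" ++
         "10201202120102";
       "012102120210201021201210201202120121020102120210201210212021020102" ++
         "120121020120212010201210212021020102120121020102120210201210212010" ++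
         "201202120121020120212010201210212021020121021201020120212012102010" ++
         "212021020121021202102010212012102012021201020121021201020120212012" ++
         "10201202120102";
       "012102120210201021201210201202120121020102120210201210212010201202" ++
         "120121020120212010201210212010201202120121020102120210201210212021" ++
         "020102120121020102120210201210212010201202120121020102120210201210" ++
         "212021020102120121020120212012102010212021020121021201020120212012" ++
         "10201202120102";
       "012102120210201021201210201202120121020102120210201210212021020102" ++
         "120121020102120210201210212010201202120121020102120210201210212021" ++
         "020102120121020120212010201210212021020121021201020120212012102010" ++
         "212021020121021202102010212012102010212021020121021201020120212012" ++
         "10201202120102";
       "012102120210201021201210201202120121020102120210201210212021020102" ++
         "120121020120212010201210212021020121021201020120212012102012021201" ++
         "020121021201020120212012102010212021020121021202102010212012102012" ++
         "021201020121021201020120212012102010212021020121021201020120212012" ++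
         "10201202120102"]%string.

Definition palindromes17 : seq (seq nat) :=
  map digits
   [:: "0"; "010"; "01210"; "020"; "02120"; "1"; "10201"; "1021201";
       "12021"; "121"; "2"; "20102"; "2012102"; "202"; "2102012"; "212"]%string.

Lemma code17_ok : code_ok (iota 0 3) 278 12 13 134 145 100 100 63 merge_variant code17.
Proof. by vm_cast_no_check (erefl true). Qed.

Lemma code17_side : side_ok 17 278 12 13 100 100 63 code17 7 palindromes17.
Proof. by vm_cast_no_check (erefl true). Qed.

Definition code18 : seq (seq nat) :=
  map digits
   [:: "102010212012101201021202102010210121021201020120212010210121021202" ++
         "102010212012101201021202101210201021201210120212010201210120102120" ++
         "210121021201021012";
       "102010212012101201021202102010210121021201020121012021201021012102" ++
         "120102012021201210120102120210121021201020120212010210121021201020" ++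
         "121012021201021012";
       "102010212012101201021202102010210121021201020120212012101201021202" ++
         "102010212012101202120102101210201021202101210212010201210120102120" ++
         "121012021201021012";
       "102010212012101201021202102010212012101202120102012101201021202102" ++
         "010210121021201020121012010212012101202120102101210212010201202120" ++
         "121012010212021012";
       "102010212012101201021202102010210121021201020120212010210121021202" ++
         "102010212012101201021202101210212010210121020102120121012021201020" ++
         "121012010212021012"]%string.

Definition palindromes18 : seq (seq nat) :=
  map digits
   [:: "0"; "1"; "2"; "010"; "020"; "101"; "121"; "202"; "212"; "01210";
       "02120"; "10201"; "12021"; "20102"; "21012"; "1021201"; "1201021"]%string.

Lemma code18_ok : code_ok (iota 0 3) 150 3 4 59 78 53 53 20 merge_variant code18.
Proof. by vm_cast_no_check (erefl true). Qed.

Lemma code18_side : side_ok 18 150 3 4 53 53 20 code18 7 palindromes18.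
Proof. by vm_cast_no_check (erefl true). Qed.

Local Open Scope ring_scope.

Theorem theorem3 (R : realType) (p : nat) (beta : rat) :
  (p, beta) \in [:: (5%N, 10 / 3);
                    (6%N, 9 / 4);
                    (7%N, 2);
                    (16%N, 52 / 27);
                    (17%N, 25 / 13);
                    (18%N, 7 / 4)] ->
  exponentially_many R
    (fun w : infword 'I_3 => plus_free beta w /\ at_most_palindromes p w).
Proof.
have beta_eq (a b : nat) (x : rat) : x = 1 + a%:R / b%:R ->
  exponentially_many R (fun w : infword 'I_3 =>
    plus_free (1 + a%:R / b%:R) w /\ at_most_palindromes p w) ->
  exponentially_many R (fun w : infword 'I_3 =>
    plus_free x w /\ at_most_palindromes p w) by move=> ->.
rewrite !inE => /orP[|/orP[|/orP[|/orP[|/orP[|]]]]] /eqP[ep ->].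
(* In each case [a / b] is [beta - 1]. *)
- apply: (beta_eq 7 3); first by field.
  by rewrite ep; exact: exponentially_many_code code5_ok code5_side.
- apply: (beta_eq 5 4); first by field.
  by rewrite ep; exact: exponentially_many_code code6_ok code6_side.
- apply: (beta_eq 1 1); first by field.
  by rewrite ep; exact: exponentially_many_code code7_ok code7_side.
- apply: (beta_eq 25 27); first by field.
  by rewrite ep; exact: exponentially_many_code code16_ok code16_side.
- apply: (beta_eq 12 13); first by field.
  by rewrite ep; exact: exponentially_many_code code17_ok code17_side.
- apply: (beta_eq 3 4); first by field.
  by rewrite ep; exact: exponentially_many_code code18_ok code18_side.
Qed.
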